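(* Suppose that for every environment $j$ in a finite set $\mathcal J$ with $|\mathcal J|\ge 2$ the $\mathbb R^p$-valued random vector $\mathbf x_j$ satisfies $$\mathbf x_j=\mathbf B\mathbf x_j+\mathbf c_j+\mathbf e_j,$$ where $\mathbf B\in\mathbb R^{p\times p}$ is deterministic and $\mathbf c_j,\mathbf e_j$ are random vectors in $\mathbb R^p$ with finite second moments, and suppose: (A) $\mathbf I-\mathbf B$ is invertible, $\mathrm{CP}(\mathbf B)<1$, and the diagonal entries of $\mathbf B$ are zero. (B) $\mathbf B$ and the distribution of $\mathbf e_j$ are the same for all $j\in\mathcal J$, and for each $j\in\mathcal J$ the vectors $\mathbf c_j$ and $\mathbf e_j$ are uncorrelated. (C) For each $j\in\mathcal J$ the covariance matrix $\mathbf\Sigma_{\mathbf c,j}=\mathrm{Cov}(\mathbf c_j)$ is diagonal. Consider the optimization problem $$\operatorname*{argmin}_{\mathbf D'\in\mathcal D_{cp}}\ \sum_{j\in\mathcal J}L\big(\mathbf D'\,\mathbf{\Delta\Sigma}_{\mathbf x,j}\,\mathbf D'^T\big).\qquad(\ast)$$ Then the solution (minimizer) of $(\ast)$ is unique if and only if for all $k,l\in\{1,\dots,p\}$ with $k\ne l$ there exist $j,j'\in\mathcal J$ such that $$\eta_{j,k}\,\eta_{j',l}\neq\eta_{j,l}\,\eta_{j',k}.$$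
   Context: Cycle-product: a cycle of length $\eta$ is a tuple $(m_1,\dots,m_{\eta+1}=m_1)\in\{1,\dots,p\}^{1+\eta}$ with $m_k\ne m_\ell$ for $1\le k<\ell\le\eta$. For $\mathbf M\in\mathbb R^{p\times p}$, $$\mathrm{CP}(\mathbf M):=\max_{(m_1,\dots,m_{\eta+1})\text{ cycle},\ 1<\eta\le p}\ \prod_{1\le k\le\eta}|\mathbf M_{m_{k+1},m_k}|$$ (the maximum over an empty set, i.e. for $p=1$, is $0$). The noise $\mathbf e_j$ has mean $0$ and a positive semi-definite covariance matrix $\mathbf\Sigma_{\mathbf e}$, which need not be diagonal. Covariances: for $\mathbf a\in\{\mathbf x,\mathbf c\}$ let $\mathbf\Sigma_{\mathbf a,j}:=\mathrm{Cov}(\mathbf a_j)$, $\mathbf\Sigma_{\mathbf a,-j}:=\frac1{|\mathcal J|-1}\sum_{j'\in\mathcal J\setminus\{j\}}\mathbf\Sigma_{\mathbf a,j'}$, and $\mathbf{\Delta\Sigma}_{\mathbf a,j}:=\mathbf\Sigma_{\mathbf a,j}-\mathbf\Sigma_{\mathbf a,-j}$. Let $\eta_{j,k}:=(\mathbf{\Delta\Sigma}_{\mathbf c,j})_{kk}$. Constraint set: $\mathcal D_{cp}:=\{\mathbf D\in\mathbb R^{p\times p}:\ \mathbf D\text{ invertible},\ \mathbf D_{kk}=1\text{ for all }k,\ \mathrm{CP}(\mathbf I-\mathbf D)<1\}$. Loss: $L(\mathbf A):=\sum_{k\ne l}\mathbf A_{k,l}^2$ (sum of squared off-diagonal entries).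 *)

(* Defs.v *)
(* MathComp / MathComp-Analysis, over an arbitrary R : realType. *)
From HB Require Import structures.
From mathcomp Require Import all_boot all_order all_algebra.
From mathcomp Require Import all_classical all_reals all_analysis.

Set Implicit Arguments.
Unset Strict Implicit.
Unset Printing Implicit Defensive.

Import Order.TTheory GRing.Theory Num.Theory.
Import numFieldNormedType.Exports.

Local Open Scope classical_set_scope.
Local Open Scope ring_scope.

(* [is_cycle m] holds for (m_0, ..., m_n) with m_n = m_0 and m_0, ..., m_(n-1)
   pairwise distinct; its length is n, its indices are shifted to start at 0. *)
Definition is_cycle (p n : nat) (m : n.+1.-tuple 'I_p) : bool :=
  (tnth m ord_max == tnth m ord0) &&
  injectiveb (fun k : 'I_n => tnth m (widen_ord (leqnSn n) k)).

(* The products are nonnegative, so the neutral element 0 of the maximum only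
   matters when there is no cycle at all, i.e. when p <= 1. *)
Definition CP (R : realType) (p : nat) (M : 'M[R]_p) : R :=
  \big[Num.max/0]_(n < p.+1 | (1 < n)%N)
    \big[Num.max/0]_(m : n.+1.-tuple 'I_p | is_cycle m)
      \prod_(k < n)
        `|M (tnth m (lift ord0 k)) (tnth m (widen_ord (leqnSn n) k))|.

(* Random vectors are measurable functions into p.-tuple R, which carries the
   product (Borel) sigma-algebra. *)
Definition rvcoord (R : realType) (p : nat) (T : Type) (X : T -> p.-tuple R)
  (k : 'I_p) : T -> R := fun w => tnth (X w) k.

Definition colvec (R : realType) (p : nat) (v : p.-tuple R) : 'cV[R]_p :=
  \col_k tnth v k.

Definition finite_second_moments (R : realType) (p : nat) (d : measure_display)
  (T : measurableType d) (P : probability T R) (X : T -> p.-tuple R) : Prop :=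
  forall k, rvcoord X k \in Lfun P 2%:E.

(* [fine] is harmless: the covariances are finite as soon as the coordinates
   have finite second moments. *)
Definition cov_mx (R : realType) (p : nat) (d : measure_display)
  (T : measurableType d) (P : probability T R) (X : T -> p.-tuple R) :
  'M[R]_p :=
  \matrix_(k, l) fine (covariance P (rvcoord X k) (rvcoord X l)).

Definition cov_other (R : realType) (p : nat) (J : finType)
  (S : J -> 'M[R]_p) (j : J) : 'M[R]_p :=
  (#|J|%:R - 1)^-1 *: \sum_(j' : J | j' != j) S j'.

Definition cov_diff (R : realType) (p : nat) (J : finType)
  (S : J -> 'M[R]_p) (j : J) : 'M[R]_p :=
  S j - cov_other S j.

Definition Dcp (R : realType) (p : nat) : set 'M[R]_p :=
  [set D | [/\ D \in unitmx, forall k, D k k = 1 & CP (1%:M - D) < 1]].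

Definition offdiag_loss (R : realType) (p : nat) (A : 'M[R]_p) : R :=
  \sum_(k < p) \sum_(l < p | k != l) A k l ^+ 2.

Definition argmin (R : realType) (U : Type) (D : set U) (f : U -> R) : set U :=
  [set x | D x /\ forall y, D y -> f x <= f y].

(* Main.v *)
(* With D0 = I - B, the model gives D0 dSx_j D0^T = dSc_j =: L_j, which is
   diagonal, so D0 has zero loss and D' in Dcp is a minimizer iff W L_j W^T is
   diagonal for all j, where W = D' D0^-1.

   If W L_j W^T = M_j is diagonal, then W L_j = M_j W^-T, so two nonzero entries
   W_ak, W_al in one row make both (eta_jk)_j and (eta_jl)_j proportional to
   ((M_j)_aa)_j. When the eta's are pairwise non-proportional, W is therefore
   monomial, with some permutation s. On a nontrivial cycle of s the normalized
   diagonals of D' and D0 make the cycle products of I - D' and of B inverse to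
   each other, which CP < 1 forbids; hence W = I.

   If (eta_jk)_j and (eta_jl)_j are proportional, adding small suitable multiples
   of row l to row k and of row k to row l of D0, then renormalizing the
   diagonal, preserves zero loss, and by continuity stays in Dcp. *)
Require Import Defs.
From HB Require Import structures.
From mathcomp Require Import all_boot all_order all_algebra.
From mathcomp Require Import all_fingroup.
From mathcomp Require Import all_classical all_reals all_analysis.
From mathcomp Require Import measurable_realfun ring.

Set Implicit Arguments.
Unset Strict Implicit.
Unset Printing Implicit Defensive.

Import Order.TTheory GRing.Theory Num.Theory.
Import numFieldNormedType.Exports.

Local Open Scope classical_set_scope.
Local Open Scope ring_scope.

(** * Cycle products: continuity, and products along orbits of permutations *)

Lemma CP_cvg (R : realType) (p : nat) (U : Type) (F : set_system U)
    (M : U -> 'M[R]_p) (N : 'M[R]_p) : Filter F ->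
  (forall a b, M u a b @[u --> F] --> N a b) ->
  CP (M u) @[u --> F] --> CP N.
Proof.
move=> FF MN; apply: cvg_big => [|n n1]; first exact: max_continuous.
apply: cvg_big => [|m _].
  exact: max_continuous.
apply: cvg_big => [|k _]; first exact: mul_continuous.
by apply: cvg_norm; exact: MN.
Qed.

(** The orbit listed as [a, s a, ..., s^n a = a], with [n] its size, is one of the cycles over which
    [CP] takes the maximum. *)
Lemma prod_porbit_le_CP (R : realType) (p : nat) (M : 'M[R]_p) (s : {perm 'I_p})
    (a : 'I_p) : s a != a ->
  \prod_(y in porbit s a) `|M (s y) y| <= CP M.
Proof.
move=> sa; set n := #|porbit s a|.
have n1 : (1 < n)%N.
  (* [iter n s a = a], so [n = 1] would make [a] a fixed point. *)
  have := iter_porbit s a; rewrite -/n.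
  have : n != 0%N by exact: card_porbit_neq0.
  by case: n => [|[|n]] //= _ /eqP; rewrite (negPf sa).
have np : (n < p.+1)%N by rewrite ltnS -[p in (_ <= p)%N]card_ord max_card.
pose m : n.+1.-tuple 'I_p := [tuple iter k s a | k < n.+1].
have mE k : tnth m k = iter k s a by rewrite tnth_mktuple.
have um : uniq (traject s a n) by exact: uniq_traject_porbit.
have cm : is_cycle m.
  rewrite /is_cycle !mE /= iter_porbit eqxx /=; apply/injectiveP => k l.
  rewrite !mE /= -!(nth_traject _ (ltn_ord _)) => /eqP.
  by rewrite nth_uniq ?size_traject// => /eqP/val_inj.
apply: le_trans (le_bigmax_cond _ _ (j := Ordinal np) _) => //=.
apply: le_trans (le_bigmax_cond _ _ (j := m) _) => //=.
rewrite le_eqVlt; apply/orP; left; apply/eqP.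
rewrite (eq_bigl (mem (traject s a n))); last by move=> y; exact: porbit_traject.
rewrite -big_uniq //= (big_nth a) size_traject big_mkord.
by apply: eq_bigr => k _; rewrite !mE /= nth_traject.
Qed.

(** * Rigidity: codiagonalizers when the diagonals are pairwise non-proportional *)

Lemma codiagonalizer_monomial (F : fieldType) (p : nat) (J : Type)
    (L : J -> 'M[F]_p) (W : 'M[F]_p) :
  W \in unitmx ->
  (forall j, is_diag_mx (L j)) ->
  (forall j, is_diag_mx (W *m L j *m W^T)) ->
  (forall k l, k != l ->
    exists j j', L j k k * L j' l l <> L j l l * L j' k k) ->
  exists s : {perm 'I_p}, forall a k, (W a k != 0) = (k == s a).
Proof.
move=> uW Ld WLd sep; set V := invmx W.
have WLE j a k : W a k * L j k k = (W *m L j *m W^T) a a * V k a.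
  have : (W *m L j) a k = (W *m L j *m W^T *m V^T) a k.
    by rewrite -mulmxA -trmx_mul mulVmx// trmx1 mulmx1.
  have /is_diag_mxP Ljd := Ld j; have /is_diag_mxP WLjd := WLd j.
  rewrite [LHS]mxE (bigD1 k)//= big1 ?addr0; last first.
    by move=> i ik; rewrite Ljd ?mulr0.
  move=> ->; rewrite [LHS]mxE (bigD1 a)//= big1 ?addr0 ?[V^T _ _]mxE//.
  by move=> i ia; rewrite WLjd ?mul0r 1?eq_sym.
have Winj a k l : W a k != 0 -> W a l != 0 -> k = l.
  move=> Wk Wl; apply/eqP/negPn/negP => /sep[j [j' []]].
  (* With [M_j = W L_j W^T], both sides multiplied by [W a k * W a l] equal
     [(M_j)_aa (M_j')_aa V_ka V_la]. *)
  apply: (mulfI Wk); apply: (mulfI Wl).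
  transitivity ((W a k * L j k k) * (W a l * L j' l l)); first by ring.
  transitivity ((W a l * L j l l) * (W a k * L j' k k)); last by ring.
  by rewrite !WLE; ring.
have Wex a : exists k, W a k != 0.
  case: (boolP [exists k, W a k != 0]) => [/existsP//|/existsPn W0].
  have : (W *m V) a a = 1 by rewrite mulmxV// mxE eqxx.
  rewrite mxE big1 => [/esym/eqP|k _]; first by rewrite oner_eq0.
  by have /negPn/eqP -> := W0 k; rewrite mul0r.
have [t tP] := choice Wex.
have W0 a k : k != t a -> W a k = 0.
  move=> kt; apply/eqP/negPn/negP => Wk.
  by rewrite (Winj a k (t a)) ?eqxx in kt.
have WV a b : W a (t a) * V (t a) b = (a == b)%:R.
  have : (W *m V) a b = (a == b)%:R by rewrite mulmxV// mxE.
  by rewrite mxE (bigD1 (t a))//= big1 ?addr0// => k /W0 ->; rewrite mul0r.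
(* If two rows [a != b] shared their nonzero column, [(W V)_ab = 0] would force [V (t a) b = 0],
   against [(W V)_bb = 1]. *)
have tinj : injective t.
  move=> a b tab; apply/eqP/negPn/negP => ab.
  have /eqP := WV a b; rewrite (negPf ab) mulf_eq0 (negPf (tP a)) /= => /eqP V0.
  have := WV b b; rewrite -tab V0 mulr0 eqxx => /esym/eqP.
  by rewrite oner_eq0.
exists (perm tinj) => a k; rewrite permE.
by case: (eqVneq k (t a)) => [->|/W0 ->]; rewrite ?tP ?eqxx.
Qed.

(* Along a nontrivial cycle of [s], the products of the entries of [1 - D] and
   of [1 - W *m D] are inverse to each other, so they cannot both be < 1. *)
Lemma Dcp_monomial_eq (R : realType) (p : nat) (D W : 'M[R]_p)
    (s : {perm 'I_p}) :
  (forall a k, (W a k != 0) = (k == s a)) ->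
  Dcp D -> Dcp (W *m D) -> W *m D = D.
Proof.
move=> Ws [_ D1 cpD] [_ WD1 cpWD].
have WDE a b : (W *m D) a b = W a (s a) * D (s a) b.
  rewrite mxE (bigD1 (s a))//= big1 ?addr0// => k /negPf ks.
  by have /negPn/eqP -> := negbT (etrans (Ws a k) ks); rewrite mul0r.
(* For [s] the identity, [W] is diagonal, and the unit diagonals of [D] and [W *m D] make its
   entries 1. *)
suff s1 a : s a = a.
  apply/matrixP => a b; rewrite WDE s1.
  by have := WD1 a; rewrite WDE s1 D1 mulr1 => ->; rewrite mul1r.
apply/eqP/negPn/negP => sa.
have neq y : y \in porbit s a -> s y != y.
  move=> /porbitP[i ->]; rewrite -permM -expgSr expgS permM.
  by rewrite (inj_eq perm_inj).
have subr1E (M : 'M[R]_p) b k : b != k -> (1%:M - M) b k = - M b k.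
  by move=> /negPf bk; rewrite !mxE bk sub0r.
(* As [D (s y) (s y) = 1], the second factor is [|W y (s y)|]; the product is then
   [|(W *m D) y y| = 1]. *)
have inv1 y : y \in porbit s a ->
    `|(1%:M - D) (s y) y| * `|(1%:M - W *m D) y (s y)| = 1.
  move=> ya; rewrite -normrM !subr1E ?neq// 1?eq_sym ?neq// WDE D1 mulr1.
  rewrite mulrNN mulrC.
  by have := WD1 y; rewrite WDE => ->; rewrite normr1.
have le1 := prod_porbit_le_CP (1%:M - D) sa.
(* The cycle for [1 - W *m D] runs backwards, along [s^-1] on the same orbit; reindexing by [s]
   aligns its factors with those of [inv1]. *)
have sVa : (s^-1)%g a != a by rewrite -(inj_eq (@perm_inj _ s)) permKV eq_sym.
have := prod_porbit_le_CP (1%:M - W *m D) sVa.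
rewrite porbitV (reindex_inj (@perm_inj _ s)) /=.
rewrite (eq_bigl (mem (porbit s a))); last first.
  move=> y; have := porbit_perm s 1 y; rewrite expg1 => syE.
  by rewrite -[LHS]eq_porbit_mem syE eq_porbit_mem.
under eq_bigr do rewrite permK.
move=> le2.
have : \prod_(y in porbit s a)
    (`|(1%:M - D) (s y) y| * `|(1%:M - W *m D) y (s y)|) = 1 by exact: big1.
rewrite big_split /= => prod1.
suff : (1 : R) < 1 by rewrite ltxx.
rewrite -[X in X < _]prod1 mulr_ilt1 ?prodr_ge0//.
  exact: le_lt_trans cpD.
exact: le_lt_trans cpWD.
Qed.

(** * Perturbation: a second codiagonalizer when two diagonals are proportional *)

Lemma det_cvg (R : realType) (p : nat) (U : Type) (F : set_system U)
    (M : U -> 'M[R]_p) (N : 'M[R]_p) : Filter F ->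
  (forall a b, M u a b @[u --> F] --> N a b) ->
  \det (M u) @[u --> F] --> \det N.
Proof.
move=> FF MN; apply: cvg_big => [|s _]; first exact: add_continuous.
apply: cvgM; first exact: cvg_cst.
by apply: cvg_big => [|i _]; [exact: mul_continuous|exact: MN].
Qed.

Lemma Dcp_other_codiagonalizer (R : realType) (p : nat) (J : Type)
    (D : 'M[R]_p) (L : J -> 'M[R]_p) (k l : 'I_p) (alpha beta : R) :
  Dcp D -> k != l -> (forall j, is_diag_mx (L j)) ->
  (forall j, alpha * L j l l = beta * L j k k) ->
  (alpha != 0) || (beta != 0) ->
  exists U : 'M[R]_p, [/\ Dcp (U *m D), U *m D != D &
    forall j, is_diag_mx (U *m L j *m U^T)].
Proof.
move=> [uD D1 cpD] kl Ld prop ab0.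
have lk : l == k = false by rewrite eq_sym (negPf kl).
(* The signs make the [(k, l)] entry of [W L_j W^T] equal to [e (alpha (L_j)_ll - beta (L_j)_kk)],
   which vanishes exactly, not just to first order in [e]. *)
pose W (e : R) : 'M[R]_p := \matrix_(a, b)
  ((a == b)%:R + e * alpha * ((a == k) && (b == l))%:R
   - e * beta * ((a == l) && (b == k))%:R).
have WME e (A : 'M[R]_p) a b : (W e *m A) a b =
    A a b + e * alpha * (a == k)%:R * A l b - e * beta * (a == l)%:R * A k b.
  rewrite mxE; under eq_bigr do rewrite mxE mulrBl mulrDl.
  rewrite sumrB big_split /=; congr (_ + _ - _).
  - rewrite (bigD1 a)//= eqxx mul1r big1 ?addr0// => i ia.
    by rewrite eq_sym (negPf ia) mul0r.
  - rewrite (bigD1 l)//= eqxx andbT big1 ?addr0// => i /negPf il.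
    by rewrite il andbF mulr0 mul0r.
  - rewrite (bigD1 k)//= eqxx andbT big1 ?addr0// => i /negPf ik.
    by rewrite ik andbF mulr0 mul0r.
have e0 : e @[e --> (0 : R)^'+] --> (0 : R).
  by apply: cvg_at_right_filter; exact: cvg_id.
have WDcvg a b : (W e *m D) a b @[e --> (0 : R)^'+] --> D a b.
  have lim : D a b + e * (alpha * (a == k)%:R * D l b)
      - e * (beta * (a == l)%:R * D k b) @[e --> (0 : R)^'+] -->
      D a b + 0 * (alpha * (a == k)%:R * D l b)
      - 0 * (beta * (a == l)%:R * D k b).
    by apply: cvgB; [apply: cvgD; [exact: cvg_cst|exact: cvgMr_tmp]|
                     exact: cvgMr_tmp].
  move: lim; rewrite !mul0r addr0 subr0.
  by under eq_fun do rewrite !mulrA -WME.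
(* Rescaling the rows restores the unit diagonal of [W e *m D]; a diagonal factor keeps [W L_j W^T]
   diagonal. The scaling tends to 1 because [D a a = 1]. *)
pose U e := diag_mx (\row_a ((W e *m D) a a)^-1) *m W e.
have UDE e a b : (U e *m D) a b = ((W e *m D) a a)^-1 * (W e *m D) a b.
  by rewrite -mulmxA mul_diag_mx [LHS]mxE [X in X * _]mxE.
have UDcvg a b : (U e *m D) a b @[e --> (0 : R)^'+] --> D a b.
  under eq_cvg do rewrite UDE.
  have lim : ((W e *m D) a a)^-1 * (W e *m D) a b @[e --> (0 : R)^'+] -->
      (D a a)^-1 * D a b.
    by apply: cvgM => //; apply: cvgV => //; rewrite D1 oner_neq0.
  by move: lim; rewrite D1 invr1 mul1r.
have detUD : \det (U e *m D) @[e --> (0 : R)^'+] --> \det D by exact: det_cvg.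
have cpUD : CP (1%:M - U e *m D) @[e --> (0 : R)^'+] --> CP (1%:M - D).
  apply: CP_cvg => a b.
  have IE (M : 'M[R]_p) : (1%:M - M) a b = (a == b)%:R - M a b by rewrite !mxE.
  rewrite IE; under eq_cvg do rewrite IE.
  by apply: cvgB => //; exact: cvg_cst.
have WDneq0 : \forall e \near (0 : R)^'+, forall a, (W e *m D) a a != 0.
  apply: filter_forall => a; apply: (cvgr_neq0 _ (WDcvg a a)).
  by rewrite D1 oner_neq0.
(* The limit is taken from the right so that [e] is nonzero, which later separates [U e] from the
   identity. *)
near (0 : R)^'+ => e.
have egt0 : 0 < e by near: e; exact: nbhs_right_gt.
have WD0 a : (W e *m D) a a != 0.
  by move: a; near: e.
exists (U e); split.
- split.
  + rewrite unitmxE unitfE; near: e; apply: (cvgr_neq0 _ detUD).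
    by rewrite -unitfE -unitmxE.
  + by move=> a; rewrite UDE mulVf.
  + by near: e; exact: (cvgr_lt _ cpUD).
(* Equality would give [U e = 1]; the [(k, l)] and [(l, k)] entries of [W e] would vanish, hence
   [alpha = beta = 0]. *)
- apply/eqP => /(congr1 (mulmx^~ (invmx D))); rewrite mulmxK// mulmxV// => U1.
  have W0 a b : a != b -> W e a b = 0.
    move=> /negPf ab; have : U e a b = 0 by rewrite U1 mxE ab.
    rewrite /U mul_diag_mx [LHS]mxE [X in X * _]mxE => /eqP.
    by rewrite mulf_eq0 invr_eq0 (negPf (WD0 a)) => /eqP.
  have /eqP := W0 _ _ kl; rewrite mxE (negPf kl) !eqxx lk /= mulr1 mulr0.
  rewrite subr0 add0r mulf_eq0 (gt_eqF egt0) /= => al0.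
  have /eqP := W0 _ _ (negbT lk); rewrite mxE (negPf kl) !eqxx lk /= mulr1 mulr0.
  rewrite addr0 sub0r oppr_eq0 mulf_eq0 (gt_eqF egt0) /= => be0.
  by rewrite al0 be0 in ab0.
- move=> j; suff /is_diag_mxP Wd : is_diag_mx (W e *m L j *m (W e)^T).
    apply/is_diag_mxP => a b ab.
    rewrite /U trmx_mul tr_diag_mx -!mulmxA mul_diag_mx mxE !mulmxA.
    by rewrite mul_mx_diag mxE Wd// mul0r mulr0.
  apply/is_diag_mxP => a b; rewrite -[_ != _ :> nat]/(a != b).
  have /is_diag_mxP Ljd := Ld j.
  rewrite -mulmxA WME.
  have LWE c d : (L j *m (W e)^T) c d = L j c c * W e d c.
    rewrite mxE (bigD1 c)//= big1 ?addr0 ?[(W e)^T _ _]mxE// => i ic.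
    by rewrite Ljd ?mul0r// eq_sym.
  rewrite !LWE !mxE !(eq_sym b) => ab.
  rewrite (negPf ab) (eq_sym l) (negPf kl).
  have pj := prop j; rewrite !eqxx.
  (* Only the entries [(k, l)] and [(l, k)] need the proportionality [pj]. *)
  have [ak|ak] := eqVneq a k.
    have al : a == l = false by rewrite ak (negPf kl).
    rewrite -ak in pj *; rewrite (negPf ab) al !andbF ?andbT /=.
    by rewrite (eq_sym l) al; case: (b == l); rewrite /=; ring: pj.
  have [al|nal] := eqVneq a l; last by rewrite !andbF /=; ring.
  rewrite -al in pj *; rewrite (eq_sym b) (negPf ab) !andbF ?andbT /=.
  by case: (k == b); rewrite /=; ring: pj.
Unshelve. all: by end_near. Qed.

(** * Minimizers of the loss as codiagonalizers *)

Lemma offdiag_loss_ge0 (R : realType) (p : nat) (A : 'M[R]_p) :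
  0 <= offdiag_loss A.
Proof. by apply: sumr_ge0 => k _; apply: sumr_ge0 => l _; exact: sqr_ge0. Qed.

Lemma offdiag_loss_eq0 (R : realType) (p : nat) (A : 'M[R]_p) :
  (offdiag_loss A == 0) = is_diag_mx A.
Proof.
have ge0 (k : 'I_p) : 0 <= \sum_(l < p | k != l) A k l ^+ 2.
  by apply: sumr_ge0 => l _; exact: sqr_ge0.
rewrite psumr_eq0//; apply/allP/is_diag_mxP => [A0 k l kl|A0 k _].
  have := A0 k (mem_index_enum _); rewrite psumr_eq0 => [|i _]; last first.
    exact: sqr_ge0.
  by move=> /allP/(_ l (mem_index_enum _))/implyP/(_ kl); rewrite sqrf_eq0 => /eqP.
by rewrite big1 ?eqxx//= => l kl; rewrite A0// expr0n.
Qed.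

(** [D0] reaches total loss 0, so the minimum of this nonnegative sum is 0, attained only when every
    term vanishes. *)
Lemma argmin_codiagonalizer (R : realType) (p : nat) (J : finType)
    (S : J -> 'M[R]_p) (D0 D : 'M[R]_p) :
  Dcp D0 -> (forall j, is_diag_mx (D0 *m S j *m D0^T)) ->
  argmin (@Dcp R p) (fun D' => \sum_j offdiag_loss (D' *m S j *m D'^T)) D <->
  Dcp D /\ forall j, is_diag_mx (D *m S j *m D^T).
Proof.
move=> cp0 diag0; have total_ge0 (D' : 'M[R]_p) :
  0 <= \sum_j offdiag_loss (D' *m S j *m D'^T).
  by apply: sumr_ge0 => j _; exact: offdiag_loss_ge0.
have total0 (D' : 'M[R]_p) : \sum_j offdiag_loss (D' *m S j *m D'^T) = 0 <->
    forall j, is_diag_mx (D' *m S j *m D'^T).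
  split=> [/eqP|dD']; last first.
    by apply: big1 => j _; apply/eqP; rewrite offdiag_loss_eq0.
  rewrite psumr_eq0 => [/allP dD' j|j _]; last exact: offdiag_loss_ge0.
  by rewrite -offdiag_loss_eq0; exact: dD' (mem_index_enum _).
split=> [[cpD minD]|[cpD /total0 D0E]]; split => //; last by move=> y _; rewrite D0E.
apply/total0/eqP; rewrite eq_le total_ge0 andbT.
by have /total0 D00 := diag0; have := minD _ cp0; rewrite /= D00.
Qed.

Lemma argmin_unique_iff (R : realType) (p : nat) (J : finType)
    (S L : J -> 'M[R]_p) (D0 : 'M[R]_p) :
  Dcp D0 -> (forall j, is_diag_mx (L j)) ->
  (forall j, D0 *m S j *m D0^T = L j) ->
  (exists! D, argmin (@Dcp R p)
     (fun D' => \sum_j offdiag_loss (D' *m S j *m D'^T)) D) <->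
  (forall k l, k != l ->
     exists j j', L j k k * L j' l l <> L j l l * L j' k k).
Proof.
move=> cp0 Ld D0L.
have diag0 j : is_diag_mx (D0 *m S j *m D0^T) by rewrite D0L.
have conj W j : (W *m D0) *m S j *m (W *m D0)^T = W *m L j *m W^T.
  by rewrite -D0L trmx_mul !mulmxA.
have uD0 : D0 \in unitmx by case: cp0.
split=> [[D [/(argmin_codiagonalizer _ cp0 diag0) _ uniqD]] k l kl|sep].
  apply: contrapT => nsep.
  have {}nsep j j' : L j k k * L j' l l = L j l l * L j' k k.
    by apply: contrapT => neq; apply: nsep; exists j, j'.
  have [alpha [beta [prop ab0]]] : exists alpha beta : R,
      (forall j, alpha * L j l l = beta * L j k k) /\
      ((alpha != 0) || (beta != 0)).
    have [[j0 ab0]|L0] :=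
        pselect (exists j, (L j k k != 0) || (L j l l != 0)).
      (* The failed inequality at the pair [j0, j] is exactly the required relation; if both
         diagonals vanish in every environment, [1, 0] serves. *)
      by exists (L j0 k k), (L j0 l l).
    exists 1, 0; rewrite oner_neq0; split=> // j.
    rewrite mul0r mul1r; apply/eqP/negPn/negP => Lj0.
    by apply: L0; exists j; rewrite Lj0 orbT.
  have [U [cpU UD0 Ud]] := Dcp_other_codiagonalizer cp0 kl Ld prop ab0.
  (* Both [U *m D0] and [D0] are minimizers, so uniqueness identifies each with [D]. *)
  case/eqP: UD0; transitivity D; [apply/esym|]; apply: uniqD.
    by apply/(argmin_codiagonalizer _ cp0 diag0); split=> // j; rewrite conj.
  exact/(argmin_codiagonalizer _ cp0 diag0).
exists D0; split=> [|D]; first exact/(argmin_codiagonalizer _ cp0 diag0).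
move=> /(argmin_codiagonalizer _ cp0 diag0) [cpD Dd].
have uD : D \in unitmx by case: cpD.
have DE : D = (D *m invmx D0) *m D0 by rewrite mulmxKV.
set W := D *m invmx D0 in DE.
have uW : W \in unitmx by rewrite unitmx_mul uD unitmx_inv.
have WLd j : is_diag_mx (W *m L j *m W^T) by rewrite -conj -DE.
have [s Ws] := codiagonalizer_monomial uW Ld WLd sep.
by rewrite DE (Dcp_monomial_eq Ws)// -DE.
Qed.

(** * Covariances under the structural equations *)

(** The average of [#|J| - 1] copies of [C] is [C], so a term common to all environments cancels in
    the difference; this removes the noise covariance, diagonal or not. *)
Lemma cov_diff_congr (R : realType) (p : nat) (J : finType)
    (S S' : J -> 'M[R]_p) (A C : 'M[R]_p) : (2 <= #|J|)%N ->
  (forall j, A *m S j *m A^T = S' j + C) ->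
  forall j, A *m cov_diff S j *m A^T = cov_diff S' j.
Proof.
move=> J2 SS' j; rewrite /cov_diff /cov_other mulmxBr mulmxBl SS'.
rewrite -scalemxAr -scalemxAl mulmx_sumr mulmx_suml.
under eq_bigr do rewrite SS'.
rewrite big_split /= sumr_const scalerDr opprD addrACA.
have -> : #|[pred j' | j' != j]| = #|J|.-1 by rewrite (cardC1 j).
rewrite -(scaler_nat _ C) scalerA -subn1 natrB ?(ltnW J2)// mulVf ?scale1r ?subrr ?addr0//.
by rewrite subr_eq0 pnatr_eq1; case: #|J| J2 => [|[]].
Qed.

Section covariance_matrices.
Context (R : realType) (d : measure_display) (T : measurableType d)
  (P : probability T R).

Lemma Lfun2_sumZ (n : nat) (a : 'I_n -> R) (f : 'I_n -> T -> R) :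
  (forall i, f i \in Lfun P 2%:E) ->
  (fun w => \sum_i a i * f i w) \in Lfun P 2%:E.
Proof.
move=> f2; rewrite (_ : (fun _ => _) = \sum_i (a i \o* f i)); last first.
  by apply/funext => w; rewrite fct_sumE; apply: eq_bigr => i _; rewrite mulrC.
apply: (big_ind (fun u => u \in Lfun P 2%:E)) => [|u v u2 v2|i _].
  - exact: Lfun_cst.
  - by rewrite rpredD ?lee1n.
  - by rewrite Lfun_scale ?ler1n.
Qed.

(** On a probability space L2 lies in L1, and a product of two L2 functions is in L1: the side
    conditions of the covariance rules. *)
Lemma Lfun2_integrability (f g : T -> R) :
  f \in Lfun P 2%:E -> g \in Lfun P 2%:E ->
  [/\ f \in Lfun P 1, g \in Lfun P 1 & (f * g)%R \in Lfun P 1].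
Proof.
by split; rewrite ?Lfun2_mul_Lfun1// Lfun_subset12// fin_num_measure.
Qed.

Lemma fine_covarianceDl (f g h : T -> R) :
  f \in Lfun P 2%:E -> g \in Lfun P 2%:E -> h \in Lfun P 2%:E ->
  fine (covariance P (f \+ g) h) =
  fine (covariance P f h) + fine (covariance P g h).
Proof.
move=> f2 g2 h2; have [f1 h1 fh1] := Lfun2_integrability f2 h2.
have [g1 _ gh1] := Lfun2_integrability g2 h2.
by rewrite covarianceDl// fineD// covariance_fin_num.
Qed.

Lemma fine_covariance_sumZl (n : nat) (a : 'I_n -> R) (f : 'I_n -> T -> R)
    (g : T -> R) : (forall i, f i \in Lfun P 2%:E) -> g \in Lfun P 2%:E ->
  fine (covariance P (fun w => \sum_i a i * f i w) g) =
  \sum_i a i * fine (covariance P (f i) g).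
Proof.
move=> f2 g2; elim: n => [|n IHn] in a f f2 *.
  rewrite big_ord0 (_ : (fun _ => _) = cst 0) ?covariance_cst_l//.
  by apply/funext => w; rewrite big_ord0.
rewrite big_ord_recl -IHn// (_ : (fun _ => _) = (a ord0 \o* f ord0) \+
    (fun w => \sum_(i < n) a (lift ord0 i) * f (lift ord0 i) w)); last first.
  by apply/funext => w; rewrite big_ord_recl /= mulrC.
have [f1 g1 fg1] := Lfun2_integrability (f2 ord0) g2.
rewrite fine_covarianceDl ?Lfun_scale ?ler1n//; last exact: Lfun2_sumZ.
by rewrite covarianceZl// fineM// covariance_fin_num.
Qed.

(** The model equation holds only almost everywhere, so moments must be carried across such
    equalities. *)
Lemma ae_eq_expectation (X Y : T -> R) :
  measurable_fun setT X -> measurable_fun setT Y ->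
  {ae P, forall w, X w = Y w} -> 'E_P[X]%E = 'E_P[Y]%E.
Proof.
move=> mX mY XY; rewrite unlock; apply: ae_eq_integral => //.
- exact/measurable_EFinP.
- exact/measurable_EFinP.
- by apply: filterS XY => w XYw _; rewrite XYw.
Qed.

Lemma ae_eq_covariance (X X' Y Y' : T -> R) :
  measurable_fun setT X -> measurable_fun setT X' ->
  measurable_fun setT Y -> measurable_fun setT Y' ->
  {ae P, forall w, X w = X' w} -> {ae P, forall w, Y w = Y' w} ->
  covariance P X Y = covariance P X' Y'.
Proof.
move=> mX mX' mY mY' XX' YY'; rewrite unlock.
rewrite (ae_eq_expectation mX mX' XX') (ae_eq_expectation mY mY' YY').
apply: ae_eq_expectation.
- by apply: measurable_funM; apply: measurable_funB.
- by apply: measurable_funM; apply: measurable_funB.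
- by apply: filterS2 XX' YY' => w Xw Yw; rewrite !fctE /= Xw Yw.
Qed.

(** [X] is replaced by the almost everywhere equal [A Z], whose coordinates are in L2 because those
    of [Z] are; bilinearity does the rest. *)
Lemma cov_mx_linear (p : nat) (A : 'M[R]_p) (X Z : T -> p.-tuple R) :
  (forall k, measurable_fun setT (rvcoord X k)) ->
  finite_second_moments P Z ->
  {ae P, forall w, colvec (X w) = A *m colvec (Z w)} ->
  cov_mx P X = A *m cov_mx P Z *m A^T.
Proof.
move=> mX Z2 XZ; apply/matrixP => k l.
pose AZ k := fun w => \sum_i A k i * rvcoord Z i w.
have AZ2 i : AZ i \in Lfun P 2%:E by exact: Lfun2_sumZ.
have mAZ i : measurable_fun setT (AZ i).
  by have := sub_Lfun_mfun (AZ2 i); rewrite inE.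
have XAZ i : {ae P, forall w, rvcoord X i w = AZ i w}.
  apply: filterS XZ => w /matrixP/(_ i 0); rewrite !mxE /rvcoord => ->.
  by apply: eq_bigr => r _; rewrite mxE.
rewrite mxE (ae_eq_covariance (mX k) (mAZ k) (mX l) (mAZ l))//.
rewrite fine_covariance_sumZl// -mulmxA mxE; apply: eq_bigr => i _.
congr (_ * _); rewrite covarianceC fine_covariance_sumZl// mxE.
by apply: eq_bigr => r _; rewrite !mxE covarianceC mulrC.
Qed.

Lemma cov_mxD (p : nat) (X Y Z : T -> p.-tuple R) :
  finite_second_moments P X -> finite_second_moments P Y ->
  (forall k l, covariance P (rvcoord X k) (rvcoord Y l) = 0%E) ->
  (forall k, rvcoord Z k = rvcoord X k \+ rvcoord Y k) ->
  cov_mx P Z = cov_mx P X + cov_mx P Y.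
Proof.
move=> X2 Y2 XY ZE; apply/matrixP => k l; rewrite !mxE !ZE.
have XY2 : rvcoord X l \+ rvcoord Y l \in Lfun P 2%:E.
  by rewrite rpredD ?lee1n.
rewrite fine_covarianceDl//.
rewrite ![covariance P _ (_ \+ _)]covarianceC.
rewrite !fine_covarianceDl//.
rewrite (covarianceC P (rvcoord Y l) (rvcoord X k)) !XY addr0 add0r.
by rewrite covarianceC (covarianceC P (rvcoord Y l)).
Qed.

End covariance_matrices.

Lemma measurable_rvcoord (R : realType) (d : measure_display)
    (T : measurableType d) (P : probability T R) (p : nat)
    (X : {RV P >-> p.-tuple R}) (k : 'I_p) : measurable_fun setT (rvcoord X k).
Proof.
rewrite (_ : rvcoord X k = (fun t : p.-tuple R => tnth t k) \o X)//.
by apply: measurableT_comp; [exact: measurable_tnth|exact: measurable_funPT].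
Qed.

(** The two vectors may live on different probability spaces; a change of variables turns the
    moments into integrals on [p.-tuple R] against the same law. *)
Lemma cov_mx_eq_distribution (R : realType) (p : nat)
    (d d' : measure_display) (T : measurableType d) (T' : measurableType d')
    (P : probability T R) (P' : probability T' R)
    (X : {RV P >-> p.-tuple R}) (X' : {RV P' >-> p.-tuple R}) :
  finite_second_moments P X -> finite_second_moments P' X' ->
  (forall A, measurable A -> distribution P X A = distribution P' X' A) ->
  cov_mx P X = cov_mx P' X'.
Proof.
move=> X2 X'2 XX'.
have eqE (f : p.-tuple R -> R) : measurable_fun setT f ->
    f \o X \in Lfun P 1 -> f \o X' \in Lfun P' 1 ->
    'E_P[f \o X]%E = 'E_P'[f \o X']%E.
  move=> mf /Lfun1_integrable fX /Lfun1_integrable fX'; rewrite unlock.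
  have mEf : measurable_fun setT (EFin \o f) by exact/measurable_EFinP.
  rewrite -(integral_distribution (X := X) mEf)//.
  rewrite -(integral_distribution (X := X') mEf)//.
  by apply: eq_measure_integral => A mA _; exact: XX'.
have X1 k : rvcoord X k \in Lfun P 1.
  by have [] := Lfun2_integrability (X2 k) (X2 k).
have X'1 k : rvcoord X' k \in Lfun P' 1.
  by have [] := Lfun2_integrability (X'2 k) (X'2 k).
have eqm k : 'E_P[rvcoord X k]%E = 'E_P'[rvcoord X' k]%E.
  exact: eqE (measurable_tnth k) (X1 k) (X'1 k).
apply/matrixP => k l; rewrite !mxE.
have [_ _ Xkl] := Lfun2_integrability (X2 k) (X2 l).
have [_ _ X'kl] := Lfun2_integrability (X'2 k) (X'2 l).
rewrite !covarianceE// !eqm; congr (fine (_ - _)%E).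
apply: (eqE (fun t => tnth t k * tnth t l)) => //.
by apply: measurable_funM; exact: measurable_tnth.
Qed.

Theorem theorem1 (R : realType) (p : nat) (J : finType) (hJ : (2 <= #|J|)%N)
  (d : J -> measure_display) (T : forall j : J, measurableType (d j))
  (P : forall j : J, probability (T j) R)
  (B : 'M[R]_p)
  (x c e : forall j : J, {RV (P j) >-> (p.-tuple R)})
  (hc2 : forall j : J, finite_second_moments (P j) (c j))
  (he2 : forall j : J, finite_second_moments (P j) (e j))
  (he0 : forall (j : J) (k : 'I_p), ('E_(P j)[rvcoord (e j) k] = 0)%E)
  (hmodel : forall j : J, {ae P j, forall w,
     colvec (x j w) = B *m colvec (x j w) + colvec (c j w) + colvec (e j w)})
  (hA1 : (1%:M - B) \in unitmx)
  (hA2 : CP B < 1)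
  (hA3 : forall k : 'I_p, B k k = 0)
  (hB1 : forall (j j' : J) (A : set (p.-tuple R)), measurable A ->
     distribution (P j) (e j) A = distribution (P j') (e j') A)
  (hB2 : forall (j : J) (k l : 'I_p),
     covariance (P j) (rvcoord (c j) k) (rvcoord (e j) l) = 0%E)
  (hC : forall j : J, is_diag_mx (cov_mx (P j) (c j))) :
  let dSx := cov_diff (fun j : J => cov_mx (P j) (x j)) in
  let dSc := cov_diff (fun j : J => cov_mx (P j) (c j)) in
  let eta := fun (j : J) (k : 'I_p) => dSc j k k in
  (exists! D : 'M[R]_p,
     argmin (@Dcp R p)
       (fun D' : 'M[R]_p => \sum_(j : J) offdiag_loss (D' *m dSx j *m D'^T)) D)
  <->
  (forall k l : 'I_p, k != l ->
     exists j j' : J, eta j k * eta j' l <> eta j l * eta j' k).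
Proof.
move=> dSx dSc eta.
have cp0 : Dcp (1%:M - B).
  by split=> // [k|]; [rewrite !mxE eqxx hA3 subr0|rewrite subKr].
apply: (argmin_unique_iff (L := dSc) cp0) => [j|].
  apply/is_diag_mxP => k l kl.
  have cd i : cov_mx (P i) (c i) k l = 0 by have /is_diag_mxP -> := hC i.
  rewrite /dSc /cov_diff /cov_other mxE cd !mxE summxE big1 => [|i _].
    by rewrite mulr0 subr0.
  exact: cd.
have [j0 _] : {j0 : J | true}.
  by have /card_gt0P/sigW[j0 _] := ltnW hJ; exists j0.
(* It remains to show [(I - B) Cov(x_j) (I - B)^T = Cov(c_j) + C], with [C] the noise covariance in
   the reference environment [j0]. *)
apply: (cov_diff_congr (C := cov_mx (P j0) (e j0)) hJ) => j.
pose Z := fun w => [tuple rvcoord (c j) k w + rvcoord (e j) k w | k < p].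
have ZE k : rvcoord Z k = rvcoord (c j) k \+ rvcoord (e j) k.
  by apply/funext => w; rewrite /rvcoord tnth_mktuple.
have Z2 : finite_second_moments (P j) Z.
  by move=> k; have := hc2 j k; have := he2 j k; rewrite ZE => e2 c2; rewrite rpredD ?lee1n.
rewrite (cov_mx_eq_distribution (he2 j0) (he2 j) (hB1 j0 j)).
rewrite -(cov_mxD (hc2 j) (he2 j) (hB2 j) ZE).
(* Almost everywhere [x_j = (I - B)^-1 Z] with [Z = c_j + e_j], so conjugation by [I - B] leaves
   [Cov(Z)]. *)
rewrite (@cov_mx_linear _ _ _ _ _ (invmx (1%:M - B)) (x j) Z)//.
- by rewrite !mulmxA mulmxV// mul1mx -mulmxA -trmx_mul mulmxV// trmx1 mulmx1.
- exact: measurable_rvcoord.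
- apply: filterS (hmodel j) => w xE.
  have -> : colvec (Z w) = (1%:M - B) *m colvec (x j w).
    rewrite mulmxBl mul1mx {1}xE -(addrA (B *m _)) addrAC subrr add0r.
    by apply/matrixP => k l; rewrite !mxE tnth_mktuple.
  by rewrite mulKmx.
Qed.
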